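(* Let $c$ be a nonzero real constant, let $H^n\cong G$ be the $n$-dimensional Poincaré half-space of constant curvature $-c^2$, realized as the Lie group $G$ with left-invariant orthonormal frame $\{X_1,\dots,X_n\}$ described in the context. For $n=2$, every left-invariant unit vector field is a biharmonic unit section and a biharmonic unit vector field. For $n>2$: (1) A left-invariant unit vector field $V=V_1X_1+\sum_{i=2}^nV_iX_i$ (with constant $V_i$) is a non-harmonic biharmonic unit section (a biharmonic unit section that is not a harmonic unit section) if and only if its coordinates lie on one of the $(n-2)$-dimensional spheres of $\mathbb{R}^n$ $C_1=\{V_1=\tfrac1{\sqrt2},\ \sum_{i=2}^nV_i^2=\tfrac12\}$ and $C_2=\{V_1=-\tfrac1{\sqrt2},\ \sum_{i=2}^nV_i^2=\tfrac12\}$. (2) The set of left-invariant biharmonic unit vector fields consists exactly of: $V=\pm X_1$; the left-invariant unit vector fields $V\in X_1^{\perp}$ (i.e. $V_1=0$); and, under the assumption $c^2<n-2$, the fields whose coordinates lie on one of the $(n-2)$-dimensional spheres $C_3=\Big\{V_1=\sqrt{\tfrac{c^2+n-2}{2(n-2)}},\ \sum_{i=2}^nV_i^2=\tfrac{n-2-c^2}{2(n-2)}\Big\}$ and $C_4=\Big\{V_1=-\sqrt{\tfrac{c^2+n-2}{2(n-2)}},\ \sum_{i=2}^nV_i^2=\tfrac{n-2-c^2}{2(n-2)}\Big\}$.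
   Context: The Poincaré half-space is $H^n=\{(y_1,\dots,y_n)\in\mathbb{R}^n: y_1>0\}$ with metric $g=(cy_1)^{-2}\sum_i(dy_i)^2$. It is isometric to the Lie group $G\subset GL(n,\mathbb{R})$ of matrices with diagonal $(e^{x_1},\dots,e^{x_1},1)$, last column $(x_2,\dots,x_n,1)^T$ and all other entries zero, with the metric for which the left-invariant fields $X_1=c\,\partial_{x_1}$, $X_i=c\,e^{x_1}\partial_{x_i}$ ($2\le i\le n$) are orthonormal. Its Levi-Civita connection is $\nabla_{X_i}X_i=cX_1$, $\nabla_{X_i}X_1=-cX_i$ for $2\le i\le n$, the remaining $\nabla_{X_i}X_j$ being zero. ''Left-invariant'' refers to this group structure. For a Riemannian manifold $(M^m,g)$ with Levi-Civita connection $\nabla$ and curvature $R(X,Y)Z=\nabla_X\nabla_YZ-\nabla_Y\nabla_XZ-\nabla_{[X,Y]}Z$, a local orthonormal frame $\{e_i\}$ and a unit vector field $V$, put $\bar\Delta V=\sum_i(\nabla_{\nabla_{e_i}e_i}V-\nabla_{e_i}\nabla_{e_i}V)$ and $S(V)=\sum_iR(\nabla_{e_i}V,V)e_i$. The vertical energy, bienergy and vertical bienergy over a compact domain $D$ are $E_1^v(V)=\frac12\int_D\|\nabla V\|^2v_g$, $E_2(V)=\frac12\int_D\{\|S(V)\|^2+\|\bar\Delta V\|^2-g(\bar\Delta V,V)^2\}v_g$, $E_2^v(V)=\frac12\int_D\{\|\bar\Delta V\|^2-g(\bar\Delta V,V)^2\}v_g$. $V$ is a harmonic unit section (resp. biharmonic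 unit vector field, biharmonic unit section) if it is a critical point of $E_1^v$ (resp. $E_2$, $E_2^v$) with respect to smooth variations through unit vector fields (supported in compact domains when $M$ is non-compact). Known characterizations, valid on any Riemannian manifold and used as the working definition: $V$ is a harmonic unit section iff $\bar\Delta V$ is pointwise collinear to $V$; $V$ is a biharmonic unit section iff $\bar\Delta[\bar\Delta V-g(\bar\Delta V,V)V]-g(\bar\Delta V,V)\bar\Delta V$ is pointwise collinear to $V$; $V$ is a biharmonic unit vector field iff $\sum_i\{R(e_i,\nabla_{e_i}S(V))V+(\nabla_{e_i}R)(e_i,S(V))V+2R(e_i,S(V))\nabla_{e_i}V\}+\bar\Delta[\bar\Delta V-g(\bar\Delta V,V)V]-g(\bar\Delta V,V)\bar\Delta V$ is pointwise collinear to $V$. *)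

(* Defs.v *)
From HB Require Import structures.
From mathcomp Require Import all_boot all_order all_algebra.
From mathcomp Require Import all_classical all_reals all_analysis.
From mathcomp Require Import ring.
Set Implicit Arguments.
Unset Strict Implicit.
Unset Printing Implicit Defensive.
Import Order.TTheory GRing.Theory Num.Theory.
Import numFieldNormedType.Exports.
Local Open Scope classical_set_scope.
Local Open Scope ring_scope.

(* Manifolds have dimension m.+1 and are covered by a single global chart,
   R^(m.+1). A vector field is given by its components in the coordinate basis,
   a Riemannian metric by its Gram matrix in that basis. The index 1 of the
   usual notation is 0 : 'I_m.+1, and 2, ..., n are the nonzero ordinals. Since
   'D is total, the operators below are meaningful for smooth fields only;
   left-invariant fields are smooth, see left_invariantP. *)
Notation vfield R m := ('rV[R]_m.+1 -> 'rV[R]_m.+1).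
Notation metric_field R m := ('rV[R]_m.+1 -> 'M[R]_m.+1).

Section RiemannianGeometry.
Context {R : realType} {m : nat}.
Implicit Types (g : metric_field R m) (X Y Z W V : vfield R m).
Implicit Types (e : 'I_m.+1 -> vfield R m).

Definition inner g X Y : 'rV[R]_m.+1 -> R :=
  fun x => (X x *m g x *m (Y x)^T) 0 0.

Definition smul (f : 'rV[R]_m.+1 -> R) X : vfield R m := fun x => f x *: X x.

Definition lie_bracket X Y : vfield R m :=
  fun x => 'D_(X x) Y x - 'D_(Y x) X x.

Definition dmetric g (l i j : 'I_m.+1) (x : 'rV[R]_m.+1) : R :=
  'D_(delta_mx 0 l : 'rV[R]_m.+1) (fun y => g y i j : R) x.

Definition christoffel g (k i j : 'I_m.+1) (x : 'rV[R]_m.+1) : R :=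
  2^-1 * \sum_l invmx (g x) k l
           * (dmetric g i j l x + dmetric g j i l x - dmetric g l i j x).

(* nabla g X Y is the Levi-Civita derivative of Y along X. *)
Definition nabla g X Y : vfield R m := fun x =>
  'D_(X x) Y x
  + \row_k \sum_i \sum_j christoffel g k i j x * X x 0 i * Y x 0 j.

Definition curvature g X Y Z : vfield R m :=
  nabla g X (nabla g Y Z) - nabla g Y (nabla g X Z)
  - nabla g (lie_bracket X Y) Z.

(* dcurvature g X Y Z W is (nabla_X R)(Y, Z) W. *)
Definition dcurvature g X Y Z W : vfield R m :=
  nabla g X (curvature g Y Z W)
  - curvature g (nabla g X Y) Z W
  - curvature g Y (nabla g X Z) W
  - curvature g Y Z (nabla g X W).

Definition orthonormal_frame g e : Prop :=
  forall i j x, inner g (e i) (e j) x = (i == j)%:R.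

Definition unit_field g V : Prop := forall x, inner g V V x = 1.

Definition collinear W V : Prop := forall x, exists k : R, W x = k *: V x.

(* In what follows e is meant to be an orthonormal frame for g; the traces do
   not depend on the choice of e. *)

Definition rough_laplacian g e V : vfield R m :=
  \sum_i (nabla g (nabla g (e i) (e i)) V - nabla g (e i) (nabla g (e i) V)).

Definition S_field g e V : vfield R m :=
  \sum_i curvature g (nabla g (e i) V) V (e i).

Definition vertical_bitension g e V : vfield R m :=
  let LV := rough_laplacian g e V in
  let lambda := inner g LV V in
  rough_laplacian g e (LV - smul lambda V) - smul lambda LV.

Definition horizontal_bitension g e V : vfield R m :=
  let SV := S_field g e V in
  \sum_i (curvature g (e i) (nabla g (e i) SV) V
          + dcurvature g (e i) (e i) SV V
          + 2 *: curvature g (e i) SV (nabla g (e i) V)).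

(* Critical points among unit fields of, respectively, the vertical energy, the
   vertical bienergy and the bienergy, expressed by their Euler-Lagrange
   equations. *)

Definition harmonic_unit_section g e V : Prop :=
  unit_field g V /\ collinear (rough_laplacian g e V) V.

Definition biharmonic_unit_section g e V : Prop :=
  unit_field g V /\ collinear (vertical_bitension g e V) V.

Definition biharmonic_unit_field g e V : Prop :=
  unit_field g V /\
  collinear (horizontal_bitension g e V + vertical_bitension g e V) V.

End RiemannianGeometry.

Section HalfSpaceGroup.
Context {R : realType} {m : nat}.
Implicit Types (x y a u v : 'rV[R]_m.+1) (c : R) (V : vfield R m).

(* The element of G with coordinates x. *)
Definition G_mx x : 'M[R]_(m + 1) :=
  block_mx (expR (x 0 0))%:M (rsubmx (x : 'rV[R]_(1 + m)))^T 0 1%:M.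

(* The group law of G in the coordinates x, see G_mx_mul. *)
Definition G_mul a x : 'rV[R]_m.+1 :=
  \row_i if i == 0 then a 0 i + x 0 i else a 0 i + expR (a 0 0) * x 0 i.

(* V is preserved by the differentials of all left translations. *)
Definition left_invariant V : Prop :=
  forall a x, 'D_(V x) (G_mul a) x = V (G_mul a x).

(* X_1 = c d/dx_1 and X_i = c e^(x_1) d/dx_i for i >= 2. *)
Definition frame c (i : 'I_m.+1) : vfield R m :=
  fun x => (c * (if i == 0 then 1 else expR (x 0 0))) *: delta_mx 0 i.

(* The metric for which frame c is orthonormal, see frame_orthonormal; it is
   the pullback of the half-space metric, see half_space_isometry. *)
Definition G_metric c : metric_field R m := fun x =>
  \matrix_(i, j) ((c ^- 2 * (if i == 0 then 1 else expR (- x 0 0) ^+ 2))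
                    *+ (i == j)).

Definition poincare_metric c : metric_field R m := fun y =>
  ((c * y 0 0) ^- 2)%:M.

Definition to_half_space x : 'rV[R]_m.+1 :=
  \row_i if i == 0 then expR (x 0 0) else x 0 i.

(* The field with constant coordinates a in the frame X_1, ..., X_n. *)
Definition const_field c a : vfield R m :=
  fun x => \sum_i a 0 i *: frame c i x.

(* V_1 = h and V_2^2 + ... + V_n^2 = s. *)
Definition coord_sphere (h s : R) : set 'rV[R]_m.+1 :=
  [set a | a 0 0 = h /\ \sum_(i < m.+1 | i != 0) a 0 i ^+ 2 = s].

Lemma G_mx_mul a x : G_mx (G_mul a x) = G_mx a *m G_mx x.
Proof.
rewrite /G_mx mulmx_block !mulmx0 !mul0mx !mulmx1 !addr0 add0r.
congr block_mx.
  by rewrite !mxE eqxx expRD -scalar_mxM.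
apply/matrixP => i j.
by rewrite mul_scalar_mx [j]ord1 !mxE /= addrC.
Qed.

Lemma G_mx_inj : (0 < m)%N -> injective G_mx.
Proof.
move=> m0 x y /eq_block_mx[/matrixP h1 /matrixP h2 _ _].
apply/rowP => i; case: (unliftP 0 i) => [j|] ->.
  have := h2 j 0; rewrite !mxE.
  suff -> : rshift 1 j = lift 0 j by [].
  exact: val_inj.
have := h1 (Ordinal m0) (Ordinal m0).
by rewrite !mxE eqxx !mulr1n => /expR_inj.
Qed.

#[local] Instance is_derive_coord (i : 'I_m.+1) x v :
  is_derive x v (fun y : 'rV[R]_m.+1 => y 0 i : R) (v 0 i).
Proof.
have @f : {linear 'rV[R]_m.+1 -> R}.
  by exists (fun N : 'rV[R]_m.+1 => N 0 i); do 2![eexists]; do ?[constructor];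
     rewrite ?mxE// => ? *; rewrite ?mxE//; move=> ?; rewrite !mxE.
have cf : continuous f by exact: coord_continuous.
have df := linear_differentiable x cf.
apply: (@DeriveDef _ _ _ _ _ f); first exact: diff_derivable.
by rewrite deriveE // diff_lin.
Qed.

#[local] Instance is_derive_exp_coord x v :
  is_derive x v (fun y : 'rV[R]_m.+1 => expR (y 0 0)) (expR (x 0 0) * v 0 0).
Proof.
have dc := @differentiable_coord R 1 m.+1 x 0 0.
have de : differentiable (expR : R -> R) (x 0 0).
  by apply/derivable1_diffP; exact: derivable_expR.
pose h := (expR \o (fun y : 'rV[R]_m.+1 => y 0 0 : R)).
have dh : differentiable h x by exact: differentiable_comp.
apply: (@DeriveDef _ _ _ _ _ h); first exact: diff_derivable.
rewrite deriveE // /h diff_comp //= -(deriveE _ dc) derive_val.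
rewrite diff1E // derive1E derive_val.
by rewrite /GRing.scale /= mulrC.
Qed.

Lemma is_derive_row (M : 'rV[R]_m.+1 -> 'rV[R]_m.+1) (d x v : 'rV[R]_m.+1) :
  (forall i, is_derive x v (fun y => M y 0 i : R) (d 0 i)) ->
  is_derive x v M d.
Proof.
move=> dM; have dMx : derivable M x v.
  by apply/derivable_mxP => i j; rewrite [i]ord1.
apply: DeriveDef => //; rewrite derive_mx //.
by apply/rowP => i; rewrite !mxE derive_val.
Qed.

Lemma derive_G_mul a x v :
  'D_v (G_mul a) x = \row_i if i == 0 then v 0 i else expR (a 0 0) * v 0 i.
Proof.
apply: derive_val; apply: is_derive_row => i.
set k := if i == 0 then 1 else expR (a 0 0).
have -> : (fun y => G_mul a y 0 i) =
    cst (a 0 i) + k *: (fun y : 'rV[R]_m.+1 => y 0 i : R).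
  apply/funext => y; rewrite mxE /k [RHS]/(a 0 i + _ * y 0 i).
  by case: ifP; rewrite ?mul1r.
have dk := is_deriveZ k (is_derive_coord i x v).
apply: (is_derive_eq (is_deriveD (is_derive_cst (a 0 i) x v) dk)).
rewrite mxE add0r [LHS](_ : _ = k * v 0 i) // /k.
by case: ifP; rewrite ?mul1r.
Qed.

Lemma derive_to_half_space x v :
  'D_v to_half_space x = \row_i if i == 0 then expR (x 0 0) * v 0 0 else v 0 i.
Proof.
apply: derive_val; apply: is_derive_row => i.
rewrite mxE (_ : (fun y => _) = if i == 0
  then (fun y : 'rV[R]_m.+1 => expR (y 0 0)) else (fun y => y 0 i)).
  by case: ifP => _; exact: _.
by apply/funext => y; rewrite mxE; case: ifP.
Qed.

Lemma half_space_isometry c (X Y : vfield R m) x : c != 0 ->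
  inner (G_metric c) X Y x =
  ('D_(X x) to_half_space x *m poincare_metric c (to_half_space x)
     *m ('D_(Y x) to_half_space x)^T) 0 0.
Proof.
move=> c0.
rewrite !derive_to_half_space /inner /poincare_metric mul_mx_scalar -scalemxAl.
have -> : X x *m G_metric c x = \row_j (X x 0 j * G_metric c x j j).
  apply/rowP => j; rewrite [LHS]mxE [RHS]mxE (bigD1 j) //= big1 ?addr0 // => k kj.
  by rewrite mxE (negPf kj) mulr0n mulr0.
rewrite !mxE big_distrr /=; apply: eq_bigr => j _.
rewrite !mxE !eqxx mulr1n /=.
have e0 : expR (x 0 0) != 0 by rewrite gt_eqF ?expR_gt0.
case: eqVneq => [->|_]; rewrite ?expRN; field; exact/andP.
Qed.

Lemma frame_orthonormal c : c != 0 -> orthonormal_frame (G_metric c) (frame c).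
Proof.
move=> c0 i j x; rewrite /inner /frame.
rewrite linearZ /= -scalemxAl -scalemxAr -scalemxAl trmx_delta.
rewrite -rowE -colE !mxE.
have [->|ij] := eqVneq i j; last by rewrite mulr0n !mulr0.
rewrite /= !mulr1n; case: ifP => _; first by rewrite !mulr1; field.
rewrite expRN; field.
by rewrite c0 gt_eqF ?expR_gt0.
Qed.

Lemma const_fieldE c a x : const_field c a x =
  \row_i (a 0 i * (c * if i == 0 then 1 else expR (x 0 0))).
Proof.
apply/rowP => i; rewrite /const_field summxE mxE (bigD1 i) //= big1 => [|k ki].
  by rewrite addr0 !mxE !eqxx mulr1.
by rewrite !mxE eqxx [i == k]eq_sym (negPf ki) !mulr0.
Qed.

Lemma left_invariantP c V : c != 0 ->
  left_invariant V <-> exists a, V = const_field c a.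
Proof.
move=> c0; split=> [VL|[a ->] b x]; last first.
  rewrite derive_G_mul !const_fieldE; apply/rowP => i; rewrite !mxE eqxx /=.
  by case: (i == 0) => //; rewrite expRD; ring.
exists (c^-1 *: V 0); apply/funext => x.
have G0 : G_mul x 0 = x.
  by apply/rowP => i; rewrite !mxE; case: ifP; rewrite ?mulr0 addr0.
rewrite -[in LHS]G0 -VL derive_G_mul const_fieldE.
apply/rowP => i; rewrite !mxE.
by case: (i == 0); field.
Qed.

End HalfSpaceGroup.

(* Main.v *)
Require Import Defs.
From mathcomp Require Import all_boot all_order all_algebra.
From mathcomp Require Import all_classical all_reals all_analysis.
From mathcomp Require Import ring lra.
Set Implicit Arguments.
Unset Strict Implicit.
Unset Printing Implicit Defensive.
Import Order.TTheory GRing.Theory Num.Theory.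
Import numFieldNormedType.Exports.
Local Open Scope classical_set_scope.
Local Open Scope ring_scope.

(* In the left-invariant frame X_1, ..., X_n the Levi-Civita connection is
   cov u v = c (<u, v> X_1 - v_1 u) on constant-coefficient fields, so every
   operator involved maps left-invariant fields to left-invariant fields and the
   Euler-Lagrange equations become identities between row vectors. With m = n - 1
   the curvature is that of constant curvature - c^2,
     rough laplacian = c^2 (v + (m - 1) v_1 X_1),
     S = - c^3 (X_1 + (m - 1) v_1 v),
   and modulo v the vertical bitension is
     c^4 (m - 1)^2 v_1 (1 - 2 v_1^2) X_1
   while the horizontal one is c^6 (m - 1) v_1 X_1. A multiple q X_1 is collinear
   to the unit vector v iff q = 0 or v_1^2 = 1. *)

Section LeftInvariantCalculus.
Context {R : realType} {m : nat}.
Implicit Types (u v w z : 'rV[R]_m.+1) (c : R).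

(** * Euclidean product of coefficient vectors *)

Definition dot u v : R := \sum_i u 0 i * v 0 i.

Lemma dotC u v : dot u v = dot v u.
Proof. by apply: eq_bigr => i _; rewrite mulrC. Qed.

Lemma dotDl u v w : dot (u + v) w = dot u w + dot v w.
Proof. by rewrite -big_split; apply: eq_bigr => i _; rewrite mxE mulrDl. Qed.

Lemma dotZl k u w : dot (k *: u) w = k * dot u w.
Proof. by rewrite big_distrr; apply: eq_bigr => i _; rewrite mxE -mulrA. Qed.

Lemma dotNl u w : dot (- u) w = - dot u w.
Proof. by rewrite -scaleN1r dotZl mulN1r. Qed.

Lemma dotDr u v w : dot w (u + v) = dot w u + dot w v.
Proof. by rewrite ![dot w _]dotC dotDl. Qed.

Lemma dotZr k u w : dot w (k *: u) = k * dot w u.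
Proof. by rewrite ![dot w _]dotC dotZl. Qed.

Lemma dotNr u w : dot w (- u) = - dot w u.
Proof. by rewrite ![dot w _]dotC dotNl. Qed.

Lemma dot_deltar u i : dot u 'e_i = u 0 i.
Proof.
rewrite /dot (bigD1 i) //= big1 ?addr0 ?mxE ?eqxx ?mulr1 // => j ji.
by rewrite mxE (negPf ji) mulr0.
Qed.

Lemma dot_deltal u i : dot 'e_i u = u 0 i.
Proof. by rewrite dotC dot_deltar. Qed.

Definition dotE :=
  (dotDl, dotDr, dotNl, dotNr, dotZl, dotZr, dot_deltal, dot_deltar).

Lemma dot_head u v :
  dot u v = u 0 0 * v 0 0 + \sum_(i < m.+1 | i != 0) u 0 i * v 0 i.
Proof. by rewrite /dot (bigD1 0). Qed.

(** * Linear and injective passage from coefficient vectors to fields *)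

Lemma const_fieldD c u v :
  const_field c (u + v) = const_field c u + const_field c v.
Proof.
apply/funext => x; rewrite [RHS]/(const_field c u x + const_field c v x).
by rewrite !const_fieldE; apply/rowP => i; rewrite !mxE mulrDl.
Qed.

Lemma const_fieldZ c k u x : const_field c (k *: u) x = k *: const_field c u x.
Proof. by rewrite !const_fieldE; apply/rowP => i; rewrite !mxE -mulrA. Qed.

Lemma const_fieldN c u : const_field c (- u) = - const_field c u.
Proof.
apply/funext => x; rewrite [RHS]/(- const_field c u x).
by rewrite !const_fieldE; apply/rowP => i; rewrite !mxE mulNr.
Qed.

Lemma const_fieldB c u v :
  const_field c (u - v) = const_field c u - const_field c v.
Proof. by rewrite const_fieldD const_fieldN. Qed.

Lemma const_field_sum c (F : 'I_m.+1 -> 'rV[R]_m.+1) :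
  const_field c (\sum_i F i) = \sum_i const_field c (F i).
Proof.
apply: (big_morph (const_field c) (const_fieldD c)).
by apply/funext => x; rewrite const_fieldE; apply/rowP => i; rewrite !mxE mul0r.
Qed.

Lemma const_field_smul c k u :
  smul (fun=> k) (const_field c u) = const_field c (k *: u).
Proof. by apply/funext => x; rewrite const_fieldZ. Qed.

Lemma const_field_delta c (i : 'I_m.+1) : const_field c 'e_i = frame c i.
Proof.
apply/funext => x; rewrite const_fieldE /frame; apply/rowP => j; rewrite !mxE /=.
by case: eqVneq => [->|_]; rewrite ?mul1r ?mulr1 // mul0r mulr0.
Qed.

(** The frame factors [c] and [c * expR (x 0 0)] never vanish, so a single point already determines
    the coefficients. *)
Lemma const_field_inj c u v x : c != 0 ->
  const_field c u x = const_field c v x -> u = v.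
Proof.
move=> c0; rewrite !const_fieldE => /rowP uv; apply/rowP => i.
have := uv i; rewrite !mxE => /mulIf; apply.
by rewrite mulf_neq0 //; case: ifP => _; rewrite ?oner_eq0 // gt_eqF ?expR_gt0.
Qed.

Lemma inner_const c u v x : c != 0 ->
  inner (G_metric c) (const_field c u) (const_field c v) x = dot u v.
Proof.
move=> c0; rewrite /inner !const_fieldE mxE; apply: eq_bigr => i _.
rewrite !mxE (bigD1 i) //= big1 ?addr0 => [|j ji]; last first.
  by rewrite !mxE (negPf ji) mulr0.
rewrite !mxE eqxx mulr1n; case: ifP => _; first by field.
rewrite expRN; field.
by rewrite c0 gt_eqF ?expR_gt0.
Qed.

(** * Derivatives of the fields and Christoffel symbols of the metric *)

Lemma is_derive_comp_coord (F : R -> R) (i : 'I_m.+1) (x v : 'rV[R]_m.+1) d :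
  is_derive (x 0 i) 1 F d ->
  is_derive x v (fun y : 'rV[R]_m.+1 => F (y 0 i)) (d * v 0 i).
Proof.
move=> dF; have dc := @differentiable_coord R 1 m.+1 x 0 i.
have dF' : differentiable F (x 0 i) by apply/derivable1_diffP; case: dF.
have dh : differentiable (F \o (fun y : 'rV[R]_m.+1 => y 0 i : R)) x.
  exact: differentiable_comp.
apply: (@DeriveDef _ _ _ _ _ (F \o _)); first exact: diff_derivable.
rewrite deriveE // diff_comp //= -(deriveE _ dc).
have [_ ->] := is_derive_coord i x v.
by rewrite diff1E // derive1E derive_val [LHS]/(_ * _) mulrC.
Qed.

Lemma derive_const_field c v (x w : 'rV[R]_m.+1) :
  'D_w (const_field c v) x =
  \row_i (v 0 i * (c * if i == 0 then 0 else expR (x 0 0) * w 0 0)).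
Proof.
apply: derive_val; apply: is_derive_row => i.
have -> : (fun y => const_field c v y 0 i) =
    (fun y => v 0 i * (c * if i == 0 then 1 else expR (y 0 0))).
  by apply/funext => y; rewrite const_fieldE mxE.
rewrite mxE; case: ifP => _.
  by rewrite !mulr0; exact: is_derive_cst.
rewrite !mulrA -[v 0 i * c * _ * _]mulrA.
rewrite (_ : (fun y => _) = (v 0 i * c) *: (fun y : 'rV[R]_m.+1 => expR (y 0 0))); last first.
  by apply/funext => y; rewrite fctE mulrA.
exact: is_deriveZ (is_derive_exp_coord x w).
Qed.

Lemma dmetric_G c l i j (x : 'rV[R]_m.+1) :
  dmetric (G_metric c) l i j x =
  (- 2 * c ^- 2 * expR (- x 0 0) ^+ 2) *+ [&& l == 0, i == j & i != 0].
Proof.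
rewrite /dmetric; apply: derive_val.
have [<-|ij] := eqVneq i j; last first.
  rewrite andbF mulr0n (_ : (fun y => _) = cst 0); first exact: is_derive_cst.
  by apply/funext => y; rewrite mxE (negPf ij).
have [i0|i0] := eqVneq i 0.
  rewrite andbF mulr0n (_ : (fun y => _) = cst (c ^- 2)); first exact: is_derive_cst.
  by apply/funext => y; rewrite mxE i0 !eqxx mulr1.
rewrite andbT; pose F (t : R) := c ^- 2 * expR (- t) ^+ 2.
rewrite (_ : (fun y => _) = (fun y : 'rV[R]_m.+1 => F (y 0 0))); last first.
  by apply/funext => y; rewrite mxE (negPf i0) eqxx mulr1n.
have dF : is_derive (x 0 0) 1 F (- 2 * c ^- 2 * expR (- x 0 0) ^+ 2).
  apply: is_derive_eq.
  rewrite /GRing.scale /= -/(c ^- 2); ring.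
apply: is_derive_eq (is_derive_comp_coord _ dF) _.
by rewrite mxE eqxx [0 == l]eq_sym mulr_natr.
Qed.

Lemma invmx_G c (x : 'rV[R]_m.+1) : c != 0 -> invmx (G_metric c x) =
  \matrix_(i, j) ((c ^+ 2 * (if i == 0 then 1 else expR (x 0 0) ^+ 2)) *+ (i == j)).
Proof.
move=> c0; set B := (RHS).
have AB : G_metric c x *m B = 1%:M.
  apply/matrixP => i j; rewrite mxE (bigD1 i) //= big1 ?addr0 => [|k ki]; last first.
    by rewrite !mxE [i == k]eq_sym (negPf ki) mulr0n mul0r.
  rewrite !mxE eqxx mulr1n; case: (eqVneq i j) => _; last by rewrite !mulr0n mulr0.
  rewrite !mulr1n; case: ifP => _; first by field.
  rewrite expRN; field.
  by rewrite c0 gt_eqF ?expR_gt0.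
have [uA _] := mulmx1_unit AB.
by rewrite -[RHS]mul1mx -(mulVmx uA) -mulmxA AB mulmx1.
Qed.

(** The metric is diagonal and depends on the first coordinate alone: the sum over [l] reduces to
    [l = k], and c^2 from the inverse cancels c^-2 from the derivative. *)
Lemma christoffel_G c k i j (x : 'rV[R]_m.+1) : c != 0 ->
  christoffel (G_metric c) k i j x =
  if k == 0 then (expR (- x 0 0) ^+ 2) *+ ((i == j) && (i != 0))
  else - (((i == 0) && (j == k))%:R + ((i == k) && (j == 0))%:R).
Proof.
move=> c0; rewrite /christoffel invmx_G // (bigD1 k) //= big1 ?addr0 => [|l lk]; last first.
  by rewrite mxE [k == l]eq_sym (negPf lk) mulr0n mul0r.
rewrite mxE eqxx mulr1n !dmetric_G.
have E0 : expR (x 0 0) != 0 by rewrite gt_eqF ?expR_gt0.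
case: (eqVneq k 0) => [->|k0].
  rewrite !andbN !andbF !mulr0n /= expRN.
  by case: (_ && _); rewrite ?mulr1n ?mulr0n; field; rewrite ?c0 ?E0.
(* For [k] nonzero, [b == k] already entails [b != 0]. *)
have absorb a b : [&& a == 0, b == k & b != 0] = (a == 0) && (b == k).
  by case: (eqVneq b k) => [->|//]; rewrite k0.
rewrite !absorb /= [(i == k) && _]andbC expRN.
by do 2!case: (_ && _); rewrite ?mulr1n ?mulr0n; field; rewrite ?c0 ?E0.
Qed.

(** * Connection, bracket and curvature in the frame *)

Definition cov c u v : 'rV[R]_m.+1 := c *: (dot u v *: 'e_0 - v 0 0 *: u).

(** In a component [k != 0] the derivative of e^(x_1) cancels the Christoffel term with [i = 0],
    which leaves - c v_1 u. In component 0 the Christoffel symbols collect the products u_i v_i with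
    [i != 0], that is, [dot u v] without its head. *)
Lemma nabla_const c u v : c != 0 ->
  nabla (G_metric c) (const_field c u) (const_field c v) = const_field c (cov c u v).
Proof.
move=> c0; apply/funext => x; rewrite /nabla derive_const_field.
apply/rowP => k; rewrite !mxE !const_fieldE !mxE eqxx.
under eq_bigr do under eq_bigr do rewrite christoffel_G //.
have E0 : expR (x 0 0) != 0 by rewrite gt_eqF ?expR_gt0.
case: (eqVneq k 0) => [->|k0].
  rewrite (bigD1 0) //= big1 => [|j _]; last by rewrite andbF mulr0n !mul0r.
  rewrite (eq_bigr (fun i => c ^+ 2 * (u 0 i * v 0 i))) => [|i i0]; last first.
    rewrite (bigD1 i) //= big1 => [|j ji].
      rewrite eqxx i0 mulr1n !mxE (negPf i0) expRN; field; exact: E0.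
    by rewrite [i == j]eq_sym (negPf ji) mulr0n !mul0r.
  rewrite -big_distrr dot_head /=; ring.
(* Each Kronecker product in the Christoffel symbols selects one entry of the double sum. *)
have pick p q (F : 'I_m.+1 -> 'I_m.+1 -> R) :
    \sum_i \sum_j ((i == p) && (j == q))%:R * F i j = F p q.
  rewrite (bigD1 p) //= [X in _ + X]big1 => [|i ip]; last first.
    by rewrite big1 // => j _; rewrite (negPf ip) mul0r.
  rewrite (bigD1 q) //= big1 => [|j jq]; last by rewrite (negPf jq) andbF mul0r.
  by rewrite !eqxx mul1r !addr0.
pose U i := u 0 i * (c * if i == 0 then 1 else expR (x 0 0)).
pose W i := v 0 i * (c * if i == 0 then 1 else expR (x 0 0)).
rewrite (eq_bigr (fun i => - \sum_j ((i == 0) && (j == k))%:R * (U i * W j)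
    - \sum_j ((i == k) && (j == 0))%:R * (U i * W j))) => [|i _]; last first.
  rewrite -!sumrN -big_split; apply: eq_bigr => j _ /=.
  by rewrite !mxE -/(U i) -/(W j); ring.
rewrite big_split /= !sumrN !pick /U /W (negPf k0) !eqxx /=; ring.
Qed.

Lemma lie_bracket_const c u v :
  lie_bracket (const_field c u) (const_field c v) =
  const_field c (c *: (u 0 0 *: v - v 0 0 *: u)).
Proof.
apply/funext => x; rewrite /lie_bracket !derive_const_field !const_fieldE.
apply/rowP => k; rewrite !mxE eqxx.
by case: eqVneq => [->|_]; ring.
Qed.

Definition curv c u v w : 'rV[R]_m.+1 :=
  - c ^+ 2 *: (dot v w *: u - dot u w *: v).

Lemma curvature_const c u v w : c != 0 ->
  curvature (G_metric c) (const_field c u) (const_field c v) (const_field c w)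
  = const_field c (curv c u v w).
Proof.
move=> c0; rewrite /curvature lie_bracket_const !nabla_const // -!const_fieldB.
congr const_field; apply/rowP => k.
rewrite /cov /curv !dotE !mxE eqxx /= [dot v u]dotC; ring.
Qed.

(** [curv] is built from [dot] alone and [cov c u] is skew for [dot], so the curvature is parallel.
    This removes the middle term of the horizontal bitension. *)
Lemma dcurvature_const c u v w z : c != 0 ->
  dcurvature (G_metric c) (const_field c u) (const_field c v) (const_field c w)
    (const_field c z) = const_field c 0.
Proof.
move=> c0; rewrite /dcurvature !(curvature_const, nabla_const) // -!const_fieldB.
congr const_field; apply/rowP => k; rewrite /cov /curv !dotE !mxE eqxx /=.
rewrite [dot w u]dotC [dot v u]dotC; ring.
Qed.

(** * Traces over the frame: rough Laplacian, S and the bitensions *)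

Lemma sum_cov c u v : \sum_i u 0 i *: cov c 'e_i v = cov c u v.
Proof.
transitivity (c *: ((\sum_i u 0 i * v 0 i) *: 'e_0 - v 0 0 *: \sum_i u 0 i *: 'e_i)
   : 'rV[R]_m.+1).
  rewrite scaler_suml scaler_sumr -sumrN -big_split scaler_sumr.
  apply: eq_bigr => i _ /=; apply/rowP => k.
  by rewrite /cov !dotE !mxE eqxx; ring.
by rewrite -row_sum_delta.
Qed.

(** The sum is the transpose of the endomorphism w |-> [cov c w u], applied to [v]. *)
Lemma sum_dot_cov c u v :
  \sum_i dot (cov c 'e_i u) v *: 'e_i = c *: (v 0 0 *: u - u 0 0 *: v) :> 'rV[R]_m.+1.
Proof.
rewrite [X in _ *: X - _](row_sum_delta u) [X in _ - _ *: X](row_sum_delta v).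
rewrite !scaler_sumr -sumrN -big_split scaler_sumr.
apply: eq_bigr => i _ /=; apply/rowP => k.
by rewrite /cov !dotE !mxE; ring.
Qed.

(** This is the divergence of the field. The direction ['e_0] contributes nothing, hence the factor
    m = n - 1. *)
Lemma sum_divergence c v : \sum_i dot (cov c 'e_i v) 'e_i = - c * m%:R * v 0 0.
Proof.
rewrite (eq_bigr (fun i => c * (v 0 i * ('e_0 : 'rV[R]_m.+1) 0 i) - c * v 0 0)) => [|i _].
  rewrite big_split /= -big_distrr -/(dot _ _) dot_deltar sumrN sumr_const card_ord /=.
  by rewrite -(mulr_natr (c * v 0 0)) -natr1; ring.
by rewrite /cov !dotE !mxE !eqxx /=; ring.
Qed.

Definition lap c v : 'rV[R]_m.+1 :=
  c ^+ 2 *: (v + ((m%:R - 1) * v 0 0) *: 'e_0).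

(** Since [cov c 'e_0] vanishes, the direction X_1 contributes nothing; each of the m others
    contributes c^2 (v_1 X_1 + v_i X_i). *)
Lemma rough_laplacian_const c v : c != 0 ->
  rough_laplacian (G_metric c) (frame c) (const_field c v) = const_field c (lap c v).
Proof.
move=> c0; rewrite /rough_laplacian.
rewrite (eq_bigr (fun i => const_field c
    (cov c (cov c 'e_i 'e_i) v - cov c 'e_i (cov c 'e_i v))))
  => [|i _]; last first.
  by rewrite -const_field_delta !nabla_const // const_fieldB.
rewrite -const_field_sum; congr const_field.
rewrite (bigD1 0) //=.
rewrite (eq_bigr (fun i => c ^+ 2 *: (v 0 0 *: 'e_0) + c ^+ 2 *: (v 0 i *: 'e_i)))
  => [|i i0]; last first.
  by apply/rowP => k; rewrite /cov !dotE !mxE !eqxx [0 == i]eq_sym (negPf i0) /=; ring.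
rewrite big_split /= sumr_const cardC1 card_ord -scaler_sumr.
(* The sum of v_i X_i over [i != 0] is v - v_1 X_1; the subtracted term turns the factor m into m -
   1. *)
have /eqP := row_sum_delta v; rewrite (bigD1 0) //= addrC -subr_eq => /eqP <-.
apply/rowP => k; rewrite /cov /lap !dotE !mxE !eqxx mulmxnE !mxE.
rewrite -(mulr_natr (_ * _)) /=; ring.
Qed.

(** [dot v v] stays as a coefficient; it becomes 1 only in the collinearity lemmas. *)
Definition S_vect c v : 'rV[R]_m.+1 :=
  - c ^+ 3 *: (dot v v *: 'e_0 + ((m%:R - 1) * v 0 0) *: v).

(** Tracing the constant curvature tensor gives S = - c^2 (nabla_V V - (div V) V). *)
Lemma S_field_const c v : c != 0 ->
  S_field (G_metric c) (frame c) (const_field c v) = const_field c (S_vect c v).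
Proof.
move=> c0; rewrite /S_field.
rewrite (eq_bigr (fun i => const_field c (curv c (cov c 'e_i v) v 'e_i)))
  => [|i _]; last first.
  by rewrite -const_field_delta nabla_const // curvature_const.
rewrite -const_field_sum; congr const_field.
rewrite /curv -scaler_sumr sumrB -scaler_suml sum_divergence.
rewrite (eq_bigr (fun i => v 0 i *: cov c 'e_i v)) => [|i _]; last by rewrite dotE.
rewrite sum_cov; apply/rowP => k; rewrite /cov /S_vect !mxE; ring.
Qed.

(** The horizontal bitension is linear in S. With [s] abstract, the three traces above can be
    applied before S is expanded. *)
Definition horizontal_vect c v (s : 'rV[R]_m.+1) : 'rV[R]_m.+1 :=
  - c ^+ 3 *: (((2 * m%:R - 1) * v 0 0) *: s + (2 * s 0 0) *: v - dot v s *: 'e_0).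

Lemma horizontal_bitension_const c v : c != 0 ->
  horizontal_bitension (G_metric c) (frame c) (const_field c v) =
  const_field c (horizontal_vect c v (S_vect c v)).
Proof.
move=> c0; rewrite /horizontal_bitension S_field_const //; set s := S_vect c v.
rewrite (eq_bigr (fun i => const_field c (- c ^+ 2 *: (
   dot (cov c 'e_i s) v *: 'e_i - v 0 i *: cov c 'e_i s
   + 2 *: (dot (cov c 'e_i v) s *: 'e_i) - (2 * dot (cov c 'e_i v) 'e_i) *: s))))
     => [|i _]; last first.
  rewrite -!const_field_delta dcurvature_const // !nabla_const // !curvature_const //.
  (* The factor 2 scales a whole field, whereas [const_fieldZ] is pointwise; hence the detour
     through a point [x]. *)
  apply/funext => x; rewrite [LHS]/(_ + _ + 2 *: _) -const_fieldZ.
  rewrite -[LHS]/((const_field c _ + const_field c _ + const_field c _) x).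
  rewrite -!const_fieldD; congr (const_field c _ x).
  apply/rowP => k; rewrite /curv [dot s _]dotC.
  rewrite [dot 'e_i (cov _ _ v)]dotC [dot 'e_i v]dotE !mxE; ring.
rewrite -const_field_sum; congr const_field.
rewrite -scaler_sumr !(sumrB, big_split) /= -!scaler_sumr !sum_dot_cov sum_cov.
rewrite -scaler_suml -big_distrr /= sum_divergence.
apply/rowP => k; rewrite /cov /horizontal_vect !mxE; ring.
Qed.

Lemma vertical_bitension_const c v : c != 0 -> dot v v = 1 ->
  vertical_bitension (G_metric c) (frame c) (const_field c v) =
  const_field c (lap c (lap c v - dot (lap c v) v *: v) - dot (lap c v) v *: lap c v).
Proof.
move=> c0 v1; rewrite /vertical_bitension rough_laplacian_const //.
have -> : inner (G_metric c) (const_field c (lap c v)) (const_field c v) =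
    fun=> dot (lap c v) v.
  by apply/funext => x; rewrite inner_const.
by rewrite !const_field_smul -const_fieldB rough_laplacian_const // -const_fieldB.
Qed.

(** * Euler-Lagrange equations as scalar equations in v_1 *)

Lemma unit_field_const c v : c != 0 ->
  unit_field (G_metric c) (const_field c v) <-> dot v v = 1.
Proof.
move=> c0; split=> [/(_ 0)|v1 x]; by rewrite inner_const.
Qed.

(** The squared length of v - v_1 X_1 is 1 - v_1^2 = 0, so every coordinate of the difference
    vanishes. *)
Lemma unit_axis v : dot v v = 1 -> v 0 0 ^+ 2 = 1 -> v = v 0 0 *: 'e_0.
Proof.
move=> v1 v02; apply/eqP; rewrite -subr_eq0; apply/eqP/rowP => i; rewrite [RHS]mxE.
have d : dot (v - v 0 0 *: 'e_0) (v - v 0 0 *: 'e_0) = (1 : R) - v 0 0 ^+ 2.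
  by rewrite !dotE v1 !mxE !eqxx /=; ring.
move: d; rewrite v02 subrr => /eqP.
rewrite psumr_eq0 => [/allP/(_ i)|j _]; last exact: sqr_ge0.
by rewrite mem_index_enum => /(_ isT); rewrite mulf_eq0 orbb => /eqP.
Qed.

(** Pairing w = k v with [v] forces k = p + q v_1, and the first coordinate then reads q (1 - v_1^2)
    = 0. Conversely, v_1^2 = 1 gives X_1 = v_1 v, so q X_1 is a multiple of [v]. *)
Lemma collinear_axis c v w (p q : R) : c != 0 -> dot v v = 1 ->
  w = p *: v + q *: 'e_0 ->
  collinear (const_field c w) (const_field c v) <-> q * ((1 : R) - v 0 0 ^+ 2) = 0.
Proof.
move=> c0 v1 ->; split=> [/(_ 0)[k]|].
  rewrite -const_fieldZ => /(const_field_inj c0) eqw.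
  have := congr1 (dot^~ v) eqw; rewrite !dotE v1 !mulr1 => eqk.
  by move/rowP/(_ 0): eqw; rewrite !mxE -eqk eqxx /=; lra.
move=> /eqP; rewrite mulf_eq0 => /orP[/eqP ->|/eqP v0] x.
  by exists p; rewrite scale0r addr0 const_fieldZ.
have v02 : v 0 0 ^+ 2 = 1 by lra.
have vE := unit_axis v1 v02.
exists (p + q * v 0 0); rewrite -const_fieldZ scalerDl; congr (const_field c (_ + _) x).
rewrite -scalerA [X in _ = _ *: (_ *: X)]vE [v 0 0 *: _]scalerA -expr2.
by rewrite v02 scale1r.
Qed.

Local Notation N := (m%:R - 1 : R).

Lemma harmonic_unit_section_const c v : c != 0 -> dot v v = 1 ->
  harmonic_unit_section (G_metric c) (frame c) (const_field c v) <->
  N * v 0 0 * ((1 : R) - v 0 0 ^+ 2) = 0.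
Proof.
move=> c0 v1; rewrite /harmonic_unit_section rough_laplacian_const //.
have -> : (N * v 0 0 * ((1 : R) - v 0 0 ^+ 2) = 0) <->
    (c ^+ 2 * (N * v 0 0) * ((1 : R) - v 0 0 ^+ 2) = 0).
  rewrite -[X in _ <-> X = _]mulrA; split=> [->|/eqP]; first by rewrite mulr0.
  by rewrite mulf_eq0 expf_eq0 (negPf c0) /= => /eqP.
rewrite -(collinear_axis (p := c ^+ 2) c0 v1 (erefl _)).
have -> : lap c v = c ^+ 2 *: v + (c ^+ 2 * (N * v 0 0)) *: 'e_0.
  by rewrite /lap scalerDr scalerA.
by split=> [[]//|]; split=> //; apply/unit_field_const.
Qed.

Lemma vertical_bitension_collinear c v : c != 0 -> dot v v = 1 ->
  collinear (vertical_bitension (G_metric c) (frame c) (const_field c v))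
    (const_field c v) <->
  c ^+ 4 * (N ^+ 2 * v 0 0 * ((1 : R) - 2 * v 0 0 ^+ 2))
    * ((1 : R) - v 0 0 ^+ 2) = 0.
Proof.
move=> c0 v1; rewrite vertical_bitension_const //.
(* Up to c^4, the coefficient of [v] is - N v_1^2 from the outer Laplacian and - (1 + N v_1^2) from
   the subtracted multiple of [lap c v]. *)
apply: (collinear_axis (p := - c ^+ 4 * (1 + 2 * N * v 0 0 ^+ 2))) => //.
apply/rowP => k; rewrite /lap !dotE v1 !mxE eqxx /=; ring.
Qed.

Lemma bitension_collinear c v : c != 0 -> dot v v = 1 ->
  collinear (horizontal_bitension (G_metric c) (frame c) (const_field c v)
     + vertical_bitension (G_metric c) (frame c) (const_field c v))
    (const_field c v) <->
  c ^+ 4 * (N * v 0 0 * (c ^+ 2 + N * ((1 : R) - 2 * v 0 0 ^+ 2)))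
    * ((1 : R) - v 0 0 ^+ 2) = 0.
Proof.
move=> c0 v1; rewrite vertical_bitension_const // horizontal_bitension_const //.
rewrite -const_fieldD.
(* The c^6 term is the coefficient of [v] in the horizontal part, the c^4 term the one in the
   vertical part. *)
apply: (collinear_axis (p := c ^+ 6 * ((2 * N + 3) * N * v 0 0 ^+ 2 + 2)
  - c ^+ 4 * (1 + 2 * N * v 0 0 ^+ 2))) => //.
apply/rowP => k; rewrite /horizontal_vect /S_vect /lap !dotE v1 !mxE eqxx /=; ring.
Qed.

(** * Coordinate spheres and solution of the scalar equations *)

Lemma coord_sphereE (h s : R) v :
  coord_sphere h s v <-> v 0 0 = h /\ dot v v = h ^+ 2 + s.
Proof.
rewrite /coord_sphere /= dot_head; split=> -[-> sE]; split=> //.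
  by rewrite -sE.
by apply: (addrI (h ^+ 2)); rewrite -sE.
Qed.

Lemma dot_head_le v : v 0 0 ^+ 2 <= dot v v.
Proof.
by rewrite dot_head -expr2 lerDl; apply: sumr_ge0 => i _; exact: sqr_ge0.
Qed.

End LeftInvariantCalculus.

Theorem theorem3p3 (R : realType) (m : nat) (c : R) (hc : c != 0) :
  let n : nat := m.+1 in
  let g : metric_field R m := G_metric c in
  let X : 'I_m.+1 -> vfield R m := frame c in
  (n = 2%N ->
    forall V : vfield R m, left_invariant V -> unit_field g V ->
      biharmonic_unit_section g X V /\ biharmonic_unit_field g X V)
  /\
  ((2 < n)%N ->
    (forall (V : vfield R m) (a : 'rV[R]_m.+1),
      left_invariant V -> unit_field g V -> V = const_field c a ->
      (biharmonic_unit_section g X V /\ ~ harmonic_unit_section g X V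
       <->
       coord_sphere (1 / Num.sqrt 2) (1 / 2) a \/
       coord_sphere (- (1 / Num.sqrt 2)) (1 / 2) a))
    /\
    (forall V : vfield R m,
      left_invariant V /\ biharmonic_unit_field g X V
      <->
      [\/ V = X 0 \/ V = - X 0,
          [/\ left_invariant V, unit_field g V
            & forall x, inner g V (X 0) x = 0]
        | c ^+ 2 < n%:R - 2 /\
          exists a : 'rV[R]_m.+1,
            V = const_field c a /\
            (coord_sphere
               (Num.sqrt ((c ^+ 2 + n%:R - 2) / (2 * (n%:R - 2))))
               ((n%:R - 2 - c ^+ 2) / (2 * (n%:R - 2))) a \/
             coord_sphere
               (- Num.sqrt ((c ^+ 2 + n%:R - 2) / (2 * (n%:R - 2))))
               ((n%:R - 2 - c ^+ 2) / (2 * (n%:R - 2))) a)])).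
Proof.
move=> n g X; split=> [n2 V|n2].
  move=> /(left_invariantP V hc)[a ->] /(unit_field_const a hc) a1.
  (* In dimension 2 the common factor m - 1 = n - 2 vanishes, so both equations are trivial. *)
  have N0 : m%:R - 1 = 0 :> R by case: n2 => ->; rewrite subrr.
  split; split; try exact/unit_field_const.
    by apply/vertical_bitension_collinear => //; rewrite N0; ring.
  by apply/bitension_collinear => //; rewrite N0; ring.
have NE : n%:R - 2 = m%:R - 1 :> R by rewrite /n -natr1; ring.
set N : R := m%:R - 1 in NE *.
have N0 : 0 < N by rewrite subr_gt0 ltr1n.
split=> [V a _ + VE|V].
  rewrite {V}VE => /(unit_field_const a hc) a1.
  have h2 : (1 / Num.sqrt 2) ^+ 2 = 2^-1 :> R.
    by rewrite expr_div_n sqr_sqrtr // expr1n div1r.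
  have -> : biharmonic_unit_section g X (const_field c a) <->
      collinear (vertical_bitension g X (const_field c a)) (const_field c a).
    by split=> [[]//|]; split=> //; exact/unit_field_const.
  rewrite vertical_bitension_collinear // harmonic_unit_section_const // -/N.
  rewrite !coord_sphereE a1 sqrrN h2.
  set h := 1 / Num.sqrt 2 in h2 *.
  have half : 1 = 2^-1 + 1 / 2 :> R by field.
  split=> [[A B]|H].
    (* The vertical equation contains the harmonic one as a factor; non-harmonicity cancels it and
       leaves 1 - 2 v_1^2 = 0. *)
    have {A} /eqP : c ^+ 4 * N * (N * a 0 0 * (1 - a 0 0 ^+ 2))
        * (1 - 2 * a 0 0 ^+ 2) = 0 by rewrite -[RHS]A; ring.
    rewrite mulf_eq0 => /orP[|/eqP A].
      by rewrite !(mulf_eq0 (_ * N)) mulf_eq0 expf_eq0 (negPf hc) (gt_eqF N0) => /eqP.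
    have /eqP : a 0 0 ^+ 2 = h ^+ 2 by rewrite h2; lra.
    by rewrite eqf_sqr => /orP[] /eqP ->; [left|right].
  have a2 : a 0 0 ^+ 2 = 2^-1 by case: H => -[-> _]; rewrite ?sqrrN.
  rewrite a2; split; first by field.
  apply/eqP; rewrite !mulf_neq0 ?(gt_eqF N0) //.
    by rewrite -sqrf_eq0 a2 invr_eq0 pnatr_eq0.
  by apply: lt0r_neq0; lra.
(* [t] is the value of v_1^2 that solves c^2 + N (1 - 2 v_1^2) = 0. *)
rewrite -addrA NE; set t := (c ^+ 2 + N) / _.
have t0 : 0 <= t.
  by apply: divr_ge0; [apply: addr_ge0|apply: mulr_ge0]; rewrite ?sqr_ge0 ?(ltW N0).
have tE : 2 * N * t = c ^+ 2 + N by rewrite /t; field; rewrite gt_eqF.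
have ts : t + (N - c ^+ 2) / (2 * N) = 1 by rewrite /t; field; rewrite gt_eqF.
(* As [c] and [N] are nonzero, only three factors of the bitension equation can vanish: v_1, 1 -
   v_1^2 and c^2 + N (1 - 2 v_1^2). *)
have bihP (a : 'rV[R]_m.+1) : biharmonic_unit_field g X (const_field c a) <->
    dot a a = 1 /\ [\/ a 0 0 = 0, a 0 0 ^+ 2 = 1 | a 0 0 ^+ 2 = t].
  split=> [[/(unit_field_const a hc) a1 /(bitension_collinear hc a1) H]|[a1 H]].
    split=> //; move: H => /eqP; rewrite -/N 2!mulf_eq0 expf_eq0 (negPf hc).
    rewrite 2!mulf_eq0 (gt_eqF N0) /=.
    case/orP=> [/orP[/eqP|/eqP H]|/eqP H]; [by constructor 1| |constructor 2; lra].
    constructor 3; apply: (mulfI (x := 2 * N)); first by rewrite mulf_neq0 ?gt_eqF.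
    by rewrite tE; lra.
  split; first exact/unit_field_const.
  apply/bitension_collinear => //; rewrite -/N.
  case: H => H; [by rewrite H; ring|by rewrite H; ring|].
  have -> : c ^+ 2 + N * (1 - 2 * a 0 0 ^+ 2) = c ^+ 2 + N - 2 * N * t by rewrite H; ring.
  by rewrite tE subrr mulr0 mulr0 mul0r.
have X0 : X 0 = const_field c 'e_0 by rewrite const_field_delta.
(* By [ts] both spheres lie in the unit sphere, and together they form its slice v_1^2 = t. *)
have sphereP (a : 'rV[R]_m.+1) : a 0 0 ^+ 2 = t /\ dot a a = 1 <->
    coord_sphere (Num.sqrt t) ((N - c ^+ 2) / (2 * N)) a \/
    coord_sphere (- Num.sqrt t) ((N - c ^+ 2) / (2 * N)) a.
  rewrite !coord_sphereE sqrrN sqr_sqrtr // ts.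
  split=> [[/eqP a0 a1]|[] [-> ->]]; rewrite ?sqrrN ?sqr_sqrtr //.
  move: a0; rewrite -[t in _ == t]sqr_sqrtr // eqf_sqr.
  by case/orP=> /eqP ->; [left|right].
split=> [[/(left_invariantP V hc)[a ->] /bihP[a1 H]]|].
  have axis : a 0 0 ^+ 2 = 1 -> const_field c a = X 0 \/ const_field c a = - X 0.
    move=> a02; rewrite (unit_axis a1 a02) X0 -const_fieldN.
    move: a02 => /eqP; rewrite sqrf_eq1 => /orP[] /eqP ->.
      by left; rewrite scale1r.
    by right; rewrite scaleN1r.
  case: H => [a0|a02|a02].
  - constructor 2; split; [by apply/(left_invariantP _ hc); exists a|exact/unit_field_const|].
    by move=> x; rewrite X0 inner_const // dotE.
  - by constructor 1; exact: axis.
  (* If c^2 >= N then t >= 1, while t = v_1^2 <= 1 for a unit vector; so v_1^2 = 1 and the field is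
     X_1 or - X_1. *)
  - case: (ltP (c ^+ 2) N) => [cN|Nc].
      by constructor 3; split=> //; exists a; split=> //; apply/sphereP.
    constructor 1; apply: axis; apply/eqP; rewrite eq_le -{1}a1 dot_head_le a02 /=.
    by rewrite -(ler_pM2l (x := 2 * N)) ?mulr_gt0 // tE; lra.
have bih (a : 'rV[R]_m.+1) : dot a a = 1 ->
    [\/ a 0 0 = 0, a 0 0 ^+ 2 = 1 | a 0 0 ^+ 2 = t] ->
    left_invariant (const_field c a) /\
    biharmonic_unit_field g X (const_field c a).
  by move=> a1 H; split; [apply/(left_invariantP _ hc); exists a|exact/bihP].
case=> [[] ->|[]|[_ [a [-> /sphereP[a0 a1]]]]].
- rewrite X0; apply: bih; first by rewrite dotE mxE !eqxx.
  by constructor 2; rewrite mxE !eqxx expr1n.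
- rewrite X0 -const_fieldN; apply: bih; first by rewrite !dotE mxE !eqxx opprK.
  by constructor 2; rewrite !mxE !eqxx sqrrN expr1n.
(* Orthogonality at the point 0 suffices, the coefficients being constant. *)
- move=> /(left_invariantP V hc)[a ->] /(unit_field_const a hc) a1 /(_ 0).
  by rewrite X0 inner_const // dotE => a0; apply: bih => //; constructor 1.
- by apply: bih => //; constructor 3.
Qed.
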